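(* Let $(V,\mu)$ be a simple, strongly connected, finite weighted directed graph. Assume that $K>0$ and that $\operatorname{diam} V=\Lambda/K$. Then for any $x,y\in V$ with $d(x,y)=\operatorname{diam}V$, the following equalities hold on $V$: $$\mathcal L\rho_x=K\rho_x+\mathcal H_x,\qquad \mathcal L\overleftarrow\rho_y=K\overleftarrow\rho_y+\overleftarrow{\mathcal H}_y.$$
   Context: **Graphs.** A finite weighted directed graph $(V,\mu)$ consists of a finite vertex set $V$ and an edge weight $\mu:V\times V\to[0,\infty)$ (not necessarily symmetric), written $\mu_{xy}=\mu(x,y)$; there is a directed edge $x\rightarrow y$ if and only if $\mu_{xy}>0$. It is simple if $\mu_{xx}=0$ for all $x\in V$. A directed path from $x$ to $y$ of length $l$ is a sequence $\{x_i\}_{i=0}^l$ with $x_0=x$, $x_l=y$, $x_i\rightarrow x_{i+1}$ for $i=0,\dots,l-1$. $(V,\mu)$ is strongly connected if for all $x,y\in V$ there is a directed path from $x$ to $y$. Graphs are assumed to have at least two vertices. The (non-symmetric) distance $d(x,y)$ is the minimum length of directed paths from $x$ to $y$; $\operatorname{diam}V=\sup_{x,y\in V}d(x,y)$. **Laplacian.** Put $\mu(x)=\sum_{y\in V}\mu_{xy}$ and $P(x,y)=\mu_{xy}/\mu(x)$. The Perron measure $\mathfrak m:V\to(0,1]$ is the unique probability measure with $\mathfrak m(x)=\sum_{y\in V}\mathfrak m(y)P(y,x)$ for all $x$. Put $\overleftarrow P(x,y)=\frac{\mathfrak m(y)}{\mathfrak m(x)}P(y,x)$ and $\mathcal P=\frac12(P+\overleftarrow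 P)$. The Chung Laplacian acts on $f:V\to\mathbb R$ by $\mathcal Lf(x)=f(x)-\sum_{y\in V}\mathcal P(x,y)f(y)$. **Ricci curvature.** For probability measures $\nu_0,\nu_1$ on $V$, the Wasserstein distance is $W(\nu_0,\nu_1)=\inf_\pi\sum_{x,y\in V}d(x,y)\pi(x,y)$, the infimum over all couplings $\pi$ of $(\nu_0,\nu_1)$ (i.e. $\sum_y\pi(x,y)=\nu_0(x)$, $\sum_x\pi(x,y)=\nu_1(y)$). For $\epsilon\in[0,1]$ let $\nu^\epsilon_x(z)=(1-\epsilon)\delta_x(z)+\epsilon\,\mathcal P(x,z)$, where $\delta_x$ is the Dirac measure. For $x\neq y$ let $\kappa_\epsilon(x,y)=1-\frac{W(\nu^\epsilon_x,\nu^\epsilon_y)}{d(x,y)}$ and $\kappa(x,y)=\lim_{\epsilon\to0}\kappa_\epsilon(x,y)/\epsilon$ with $\epsilon>0$ (this limit exists). Set $K:=\inf_{x\rightarrow y}\kappa(x,y)$, the infimum over all $x,y\in V$ with $x\rightarrow y$. **Mean curvature.** Let $\rho_x(z)=d(x,z)$, $\overleftarrow\rho_x(z)=d(z,x)$, $\mathcal H_x=\mathcal L\rho_x(x)$, $\overleftarrow{\mathcal H}_x=\mathcal L\overleftarrow\rho_x(x)$, $\mathcal H(x,y)=-(\mathcal H_x+\overleftarrow{\mathcal H}_y)$ for $x,y\in V$, and $\Lambda:=\sup_{x,y\in V}\mathcal H(x,y)$. *)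

(* Defs.v *)
From HB Require Import structures.
From mathcomp Require Import all_boot all_order all_algebra.
From mathcomp Require Import all_classical all_reals all_analysis.

Set Implicit Arguments.
Unset Strict Implicit.
Unset Printing Implicit Defensive.

Import Order.TTheory GRing.Theory Num.Theory.
Import numFieldNormedType.Exports.

Local Open Scope classical_set_scope.
Local Open Scope ring_scope.

(* Finite weighted directed graphs (V, mu), in MathComp-Analysis. *)

Definition edge (R : realType) (V : finType) (mu : V -> V -> R) : rel V :=
  fun x y => 0 < mu x y.

Definition simple_graph (R : realType) (V : finType) (mu : V -> V -> R) : Prop :=
  forall x, mu x x = 0.

(* The path is x :: p, so its length is the size of p. *)
Definition dipath (R : realType) (V : finType) (mu : V -> V -> R)
    (x y : V) (l : nat) : bool :=
  [exists p : l.-tuple V, path (edge mu) x p && (last x p == y)].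

Definition strongly_connected (R : realType) (V : finType)
    (mu : V -> V -> R) : Prop :=
  forall x y, exists l, dipath mu x y l.

(* The value is 0 by convention when y cannot be reached from x, which never
   happens in a strongly connected graph. *)
Definition ddist (R : realType) (V : finType) (mu : V -> V -> R)
    (x y : V) : nat :=
  match pselect (exists l, dipath mu x y l) with
  | left h => ex_minn h
  | right _ => 0
  end.

Definition diam (R : realType) (V : finType) (mu : V -> V -> R) : nat :=
  (\max_(x : V) \max_(y : V) ddist mu x y)%N.

Definition vweight (R : realType) (V : finType) (mu : V -> V -> R) (x : V) : R :=
  \sum_(y : V) mu x y.

Definition trans (R : realType) (V : finType) (mu : V -> V -> R) (x y : V) : R :=
  mu x y / vweight mu x.

(* On a strongly connected graph with at least two vertices such an m exists, is
   unique, and takes its values in ]0, 1]. *)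
Definition perron_measure (R : realType) (V : finType) (mu : V -> V -> R)
    (m : V -> R) : Prop :=
  [/\ forall x, 0 <= m x,
      \sum_(x : V) m x = 1
    & forall x, m x = \sum_(y : V) m y * trans mu y x].

Definition rev_trans (R : realType) (V : finType) (mu : V -> V -> R)
    (m : V -> R) (x y : V) : R :=
  m y / m x * trans mu y x.

Definition mean_trans (R : realType) (V : finType) (mu : V -> V -> R)
    (m : V -> R) (x y : V) : R :=
  2^-1 * (trans mu x y + rev_trans mu m x y).

Definition laplacian (R : realType) (V : finType) (mu : V -> V -> R)
    (m : V -> R) (f : V -> R) (x : V) : R :=
  f x - \sum_(y : V) mean_trans mu m x y * f y.

Definition coupling (R : realType) (V : finType) (nu0 nu1 : V -> R)
    (pi : V -> V -> R) : Prop :=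
  [/\ forall x y, 0 <= pi x y,
      forall x, \sum_(y : V) pi x y = nu0 x
    & forall y, \sum_(x : V) pi x y = nu1 y].

Definition wasserstein (R : realType) (V : finType) (mu : V -> V -> R)
    (nu0 nu1 : V -> R) : R :=
  inf [set \sum_(x : V) \sum_(y : V) (ddist mu x y)%:R * pi x y
      | pi in [set pi : V -> V -> R | coupling nu0 nu1 pi]].

Definition lazy_walk (R : realType) (V : finType) (mu : V -> V -> R)
    (m : V -> R) (eps : R) (x z : V) : R :=
  (1 - eps) * (z == x)%:R + eps * mean_trans mu m x z.

Definition kappa_eps (R : realType) (V : finType) (mu : V -> V -> R)
    (m : V -> R) (eps : R) (x y : V) : R :=
  1 - wasserstein mu (lazy_walk mu m eps x) (lazy_walk mu m eps y)
      / (ddist mu x y)%:R.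

Definition kappa (R : realType) (V : finType) (mu : V -> V -> R)
    (m : V -> R) (x y : V) : R :=
  lim (kappa_eps mu m eps x y / eps @[eps --> 0^'+]).

Definition inf_ricci (R : realType) (V : finType) (mu : V -> V -> R)
    (m : V -> R) : R :=
  inf [set kappa mu m xy.1 xy.2 | xy in [set xy : V * V | edge mu xy.1 xy.2]].

Definition rho (R : realType) (V : finType) (mu : V -> V -> R) (x z : V) : R :=
  (ddist mu x z)%:R.

Definition rev_rho (R : realType) (V : finType) (mu : V -> V -> R)
    (x z : V) : R :=
  (ddist mu z x)%:R.

Definition mean_curv (R : realType) (V : finType) (mu : V -> V -> R)
    (m : V -> R) (x : V) : R :=
  laplacian mu m (rho mu x) x.

Definition rev_mean_curv (R : realType) (V : finType) (mu : V -> V -> R)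
    (m : V -> R) (x : V) : R :=
  laplacian mu m (rev_rho mu x) x.

Definition mixed_mean_curv (R : realType) (V : finType) (mu : V -> V -> R)
    (m : V -> R) (x y : V) : R :=
  - (mean_curv mu m x + rev_mean_curv mu m y).

Definition sup_mean_curv (R : realType) (V : finType) (mu : V -> V -> R)
    (m : V -> R) : R :=
  sup [set mixed_mean_curv mu m xy.1 xy.2 | xy in [set: V * V]].

(* Main.v *)
(* If f is 1-Lipschitz and increases by 1 along an edge w -> z, testing the
   Wasserstein distance against f gives K <= L f z - L f w.  Summing this along
   geodesics, with f = d(x, .) and f = - d(., y), gives the comparisons
     L rho_x >= K rho_x + H_x   and   L rev_rho_y >= K rev_rho_y + rev_H_y.
   Put f = rho_x + rev_rho_y, so that f >= d(x, y) = D by the triangle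
   inequality.  Adding the comparisons, L f >= K f - H(x, y) >= K f - K D >= 0,
   whereas L f has mean zero for the Perron measure, which is positive.  Hence
   L f = 0, and both comparisons are equalities. *)
Require Import Defs.
From HB Require Import structures.
From mathcomp Require Import all_boot all_order all_algebra.
From mathcomp Require Import all_classical all_reals all_analysis.
From mathcomp Require Import ring lra.

Set Implicit Arguments.
Unset Strict Implicit.
Unset Printing Implicit Defensive.

Import Order.TTheory GRing.Theory Num.Theory.
Import numFieldNormedType.Exports.

Local Open Scope classical_set_scope.
Local Open Scope ring_scope.

(** The sum of all absolute values dominates each of them. Such a bound is what allows an infimum of
    curvatures to be compared with a single curvature. *)
Lemma has_lbound_image_fin (R : realType) (T : finType) (g : T -> R)
    (A : set T) : has_lbound [set g t | t in A].
Proof.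
exists (- \sum_t `|g t|) => _ [t _ <-].
rewrite lerNl (le_trans (ler_norm _)) // normrN (bigD1 t) //= lerDl.
exact: sumr_ge0.
Qed.

Lemma has_ubound_image_fin (R : realType) (T : finType) (g : T -> R)
    (A : set T) : has_ubound [set g t | t in A].
Proof.
exists (\sum_t `|g t|) => _ [t _ <-].
rewrite (le_trans (ler_norm _)) // (bigD1 t) //= lerDl.
exact: sumr_ge0.
Qed.

(** * Directed paths and the non-symmetric distance *)

Section Distance.
Variables (R : realType) (V : finType) (mu : V -> V -> R).
Implicit Types x y z w : V.

Lemma dipathP x y l :
  reflect (exists p, [/\ size p = l, path (edge mu) x p & last x p = y])
          (dipath mu x y l).
Proof.
apply: (iffP existsP) => [[p /andP[xp /eqP py]]|[p [<- xp py]]].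
  by exists p; rewrite size_tuple.
by exists (in_tuple p); rewrite xp py /=.
Qed.

Lemma dipath0 x : dipath mu x x 0.
Proof. by apply/dipathP; exists [::]. Qed.

Lemma dipath1 x y : edge mu x y -> dipath mu x y 1.
Proof. by move=> xy; apply/dipathP; exists [:: y]; rewrite /= xy. Qed.

Lemma dipath_cat x y z k l :
  dipath mu x y k -> dipath mu y z l -> dipath mu x z (k + l).
Proof.
move=> /dipathP[p [<- xp py]] /dipathP[q [<- yq qz]]; apply/dipathP.
by exists (p ++ q); rewrite size_cat cat_path last_cat py xp yq.
Qed.

Lemma dipath_first x z n : dipath mu x z n.+1 ->
  exists2 w, edge mu x w & dipath mu w z n.
Proof.
move=> /dipathP[[|w p] [//= [sp] /andP[xw wp] pz]].
by exists w => //; apply/dipathP; exists p.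
Qed.

Lemma dipath_last x z n : dipath mu x z n.+1 ->
  exists2 w, dipath mu x w n & edge mu w z.
Proof.
move=> /dipathP[p [+ + <-]]; case/lastP: p => [//|p w].
rewrite size_rcons rcons_path last_rcons => -[sp] /andP[xp pw].
by exists (last x p) => //; apply/dipathP; exists p.
Qed.

Hypothesis mu_conn : strongly_connected mu.

Lemma dipath_ddist x y : dipath mu x y (ddist mu x y).
Proof.
by rewrite /ddist; case: pselect => [h|/(_ (mu_conn x y))//]; case: ex_minnP.
Qed.

Lemma ddist_le x y l : dipath mu x y l -> (ddist mu x y <= l)%N.
Proof.
rewrite /ddist; case: pselect => [h|/(_ (mu_conn x y))//] xy.
by case: ex_minnP => n _; apply.
Qed.

Lemma ddistxx x : ddist mu x x = 0%N.
Proof. by apply/eqP; rewrite -leqn0; exact/ddist_le/dipath0. Qed.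

Lemma ddist_eq0 x y : ddist mu x y = 0%N -> x = y.
Proof.
by have := dipath_ddist x y => /[swap] -> /dipathP[p [/size0nil -> _ /=]].
Qed.

Lemma ddist_triangle x y z :
  (ddist mu x z <= ddist mu x y + ddist mu y z)%N.
Proof.
by apply: ddist_le; apply: dipath_cat (dipath_ddist _ _) (dipath_ddist _ _).
Qed.

Lemma ddist_edge x y : edge mu x y -> (ddist mu x y <= 1)%N.
Proof. by move=> xy; exact/ddist_le/dipath1. Qed.

(** Take the penultimate vertex of a geodesic: the truncated path gives one bound on its distance,
    the triangle inequality through the last edge the other. *)
Lemma ddist_pred_last x z n : ddist mu x z = n.+1 ->
  exists2 w, ddist mu x w = n & edge mu w z.
Proof.
move=> xz; have := dipath_ddist x z; rewrite xz => /dipath_last[w xw wz].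
exists w => //; apply/eqP; rewrite eqn_leq ddist_le //= -ltnS -xz.
by rewrite (leq_trans (ddist_triangle x w z)) // -addn1 leq_add2l ddist_edge.
Qed.

Lemma ddist_pred_first x z n : ddist mu x z = n.+1 ->
  exists2 w, edge mu x w & ddist mu w z = n.
Proof.
move=> xz; have := dipath_ddist x z; rewrite xz => /dipath_first[w xw wz].
exists w => //; apply/eqP; rewrite eqn_leq ddist_le //= -ltnS -xz.
by rewrite (leq_trans (ddist_triangle x w z)) // -add1n leq_add2r ddist_edge.
Qed.

End Distance.

(** * Perron measure, lazy walks and the Laplacian comparison *)

Section Comparison.
Variables (R : realType) (V : finType) (mu : V -> V -> R) (m : V -> R).
Hypothesis card_V : (1 < #|V|)%N.
Hypothesis mu_ge0 : forall x y, 0 <= mu x y.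
Hypothesis mu_conn : strongly_connected mu.
Hypothesis m_perron : perron_measure mu m.
Implicit Types x y z w : V.

(** A path from [x] to some other vertex starts with an edge leaving [x]. *)
Lemma vweight_gt0 x : 0 < vweight mu x.
Proof.
have [y yx] : exists y, y != x.
  apply/existsP; apply: contraTT card_V => /existsPn /= h.
  rewrite -leqNgt -(card1 x); apply/subset_leq_card/fintype.subsetP => y _.
  by have := h y; rewrite negbK.
have [l /dipathP[[|w p] [_ /=]]] := mu_conn x y.
  by move=> _ xy; rewrite xy eqxx in yx.
case/andP=> xw _ _; rewrite /vweight (bigD1 w) //=.
by rewrite ltr_pwDl // sumr_ge0.
Qed.

Lemma trans_ge0 x y : 0 <= trans mu x y.
Proof. by rewrite divr_ge0 // ltW // vweight_gt0. Qed.

Lemma sum_trans x : \sum_y trans mu x y = 1.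
Proof. by rewrite -mulr_suml divff // gt_eqF // vweight_gt0. Qed.

(** Stationarity carries positive mass along edges. Some vertex has positive mass because the total
    is 1, and paths from it reach every vertex. *)
Lemma perron_gt0 x : 0 < m x.
Proof.
have [m_ge0 m_sum1 m_stat] := m_perron.
have stepP y z : edge mu y z -> 0 < m y -> 0 < m z.
  move=> yz my; rewrite m_stat (bigD1 y) //= ltr_pwDl //.
    by rewrite mulr_gt0 // divr_gt0 // vweight_gt0.
  by rewrite sumr_ge0 // => w _; rewrite mulr_ge0 // trans_ge0.
have [y my] : exists y, 0 < m y.
  apply: contrapT => /forallNP m0; have := oner_neq0 R.
  rewrite -m_sum1 big1 ?eqxx // => y _; apply/eqP.
  by rewrite eq_le m_ge0 andbT leNgt; apply/negP/m0.
have [l /dipathP[p [_ + <-]]] := mu_conn y x.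
elim: p y my => //= z p IHp y my /andP[yz zp].
exact: IHp (stepP _ _ yz my) zp.
Qed.

Lemma mean_trans_ge0 x y : 0 <= mean_trans mu m x y.
Proof.
rewrite mulr_ge0 ?invr_ge0 // addr_ge0 ?trans_ge0 //.
by rewrite mulr_ge0 ?trans_ge0 // divr_ge0 // ltW // perron_gt0.
Qed.

Lemma sum_mean_trans x : \sum_y mean_trans mu m x y = 1.
Proof.
have [_ _ m_stat] := m_perron.
rewrite -mulr_sumr big_split /= sum_trans.
rewrite [X in 1 + X](_ : _ = \sum_y m y * trans mu y x / m x); last first.
  by apply: eq_bigr => y _; rewrite /Defs.rev_trans mulrAC.
rewrite -mulr_suml -m_stat divff ?gt_eqF ?perron_gt0 //.
by rewrite mulVf.
Qed.

Lemma perron_mean_trans y : \sum_x m x * mean_trans mu m x y = m y.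
Proof.
have [_ _ m_stat] := m_perron.
(* The summand is symmetric in [x] and [y]: the averaged kernel is reversible for [m]. *)
transitivity (\sum_x 2^-1 * (m x * trans mu x y + m y * trans mu y x)).
  apply: eq_bigr => x _; rewrite /mean_trans /Defs.rev_trans.
  by field; rewrite gt_eqF // perron_gt0.
rewrite -mulr_sumr big_split /= -m_stat -mulr_sumr sum_trans mulr1.
by field.
Qed.

Lemma perron_laplacian f : \sum_x m x * laplacian mu m f x = 0.
Proof.
under eq_bigr do rewrite /laplacian mulrBr mulr_sumr.
rewrite sumrB exchange_big /=; apply/eqP; rewrite subr_eq0; apply/eqP.
apply: eq_bigr => y _; rewrite -[in LHS](perron_mean_trans y) mulr_suml.
by apply: eq_bigr => x _; rewrite [RHS]mulrA.
Qed.

Lemma lazy_walk_ge0 e x z : 0 <= e <= 1 -> 0 <= lazy_walk mu m e x z.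
Proof.
case/andP=> e0 e1; rewrite addr_ge0 // mulr_ge0 ?subr_ge0 //.
exact: mean_trans_ge0.
Qed.

(** Kept for arbitrary [f]: the constant 1 gives the total mass, and a Lipschitz [f] brings the
    Laplacian into the Wasserstein bound. *)
Lemma lazy_walk_mean e x f :
  \sum_z lazy_walk mu m e x z * f z = f x - e * laplacian mu m f x.
Proof.
under eq_bigr do rewrite /lazy_walk mulrDl.
rewrite big_split /= (bigD1 x) //= eqxx big1 => [|z /negPf->]; last first.
  by rewrite mulr0 mul0r.
under eq_bigr do rewrite -mulrA.
by rewrite -mulr_sumr mulr1 /laplacian; ring.
Qed.

Lemma sum_lazy_walk e x : \sum_z lazy_walk mu m e x z = 1.
Proof.
transitivity (\sum_z lazy_walk mu m e x z * 1).
  by apply: eq_bigr => z _; rewrite mulr1.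
rewrite lazy_walk_mean /laplacian.
under eq_bigr do rewrite mulr1.
by rewrite sum_mean_trans subrr mulr0 subr0.
Qed.

(* Easy half of Kantorovich duality; the product coupling shows that the
   infimum is not taken over the empty set. *)
Lemma wasserstein_ge (nu0 nu1 f : V -> R) :
  (forall x, 0 <= nu0 x) -> \sum_x nu0 x = 1 ->
  (forall x, 0 <= nu1 x) -> \sum_x nu1 x = 1 ->
  (forall x y, f y - f x <= (ddist mu x y)%:R) ->
  \sum_y nu1 y * f y - \sum_x nu0 x * f x <= wasserstein mu nu0 nu1.
Proof.
move=> nu0_ge0 nu0_sum1 nu1_ge0 nu1_sum1 fLip; apply: lb_le_inf.
  eexists; exists (fun x y => nu0 x * nu1 y); last reflexivity; split.
  - by move=> x y; rewrite mulr_ge0.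
  - by move=> x; rewrite -mulr_sumr nu1_sum1 mulr1.
  - by move=> y; rewrite -mulr_suml nu0_sum1 mul1r.
move=> _ [pi [pi_ge0 pi0 pi1] <-].
under [X in X - _]eq_bigr do rewrite -pi1 mulr_suml.
under [X in _ - X]eq_bigr do rewrite -pi0 mulr_suml.
rewrite exchange_big -sumrB ler_sum // => x _.
rewrite -sumrB ler_sum // => y _.
by rewrite -mulrBr mulrC ler_wpM2r.
Qed.

Hypothesis K_gt0 : 0 < inf_ricci mu m.

(* [lim] is 0 when the limit does not exist, so that [K > 0] forces the limits
   defining [kappa] on edges to exist. *)
Lemma inf_ricci_le_laplacian f w z :
  (forall x y, f y - f x <= (ddist mu x y)%:R) ->
  edge mu w z -> f z - f w = 1 ->
  inf_ricci mu m <= laplacian mu m f z - laplacian mu m f w.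
Proof.
move=> fLip wz fwz.
(* The edge bounds the distance above; the unit increase of the 1-Lipschitz [f] bounds it below. *)
have dwz : ddist mu w z = 1%N.
  apply/eqP; rewrite eqn_leq (ddist_edge mu_conn wz) /=.
  by rewrite -(ler_nat R) (le_trans _ (fLip w z)) ?fwz.
have Kle : inf_ricci mu m <= kappa mu m w z.
  apply: ge_inf; last by exists (w, z).
  exact: has_lbound_image_fin.
apply: (le_trans Kle); apply: limr_le.
  apply: contrapT => /dvgP lim0; have := lt_le_trans K_gt0 Kle.
  by rewrite /kappa lim0 ltxx.
near=> e.
have e0 : 0 < e by near: e; exact: nbhs_right_gt.
have e1 : e <= 1 by near: e; exact: nbhs_right_le.
rewrite ler_pdivrMr // /kappa_eps dwz divr1.
have e01 : 0 <= e <= 1 by rewrite ltW.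
(* Since [f z - f w = 1], duality bounds the Wasserstein distance below by
   [1 - e * (L f z - L f w)], where [L] is the Laplacian; the first-order term in [e] is what
   remains of the curvature. *)
have := wasserstein_ge (lazy_walk_ge0 w ^~ e01) (sum_lazy_walk e w)
  (lazy_walk_ge0 z ^~ e01) (sum_lazy_walk e z) fLip.
rewrite !lazy_walk_mean.
by move: fwz; lra.
Unshelve. all: by end_near. Qed.

Lemma laplacian_rho_ge x z :
  inf_ricci mu m * rho mu x z + mean_curv mu m x <= laplacian mu m (rho mu x) z.
Proof.
rewrite {1}/rho; move nE : (ddist mu x z) => n.
elim: n z nE => [|n IHn] z xz.
  by rewrite mulr0 add0r (ddist_eq0 mu_conn xz).
have [w xw wz] := ddist_pred_last mu_conn xz.
have rhoLip a b : rho mu x b - rho mu x a <= (ddist mu a b)%:R.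
  by rewrite lerBlDl -natrD ler_nat ddist_triangle.
have rho1 : rho mu x z - rho mu x w = 1.
  by rewrite /rho xz xw -natr1; ring.
have := inf_ricci_le_laplacian rhoLip wz rho1.
by have := IHn w xw; lra.
Qed.

Lemma laplacian_rev_rho_ge y z :
  inf_ricci mu m * rev_rho mu y z + rev_mean_curv mu m y
  <= laplacian mu m (rev_rho mu y) z.
Proof.
rewrite {1}/rev_rho; move nE : (ddist mu z y) => n.
elim: n z nE => [|n IHn] z zy.
  by rewrite mulr0 add0r (ddist_eq0 mu_conn zy).
have [w zw wy] := ddist_pred_first mu_conn zy.
(* The sign matters because the distance is not symmetric: the triangle inequality makes
   [- rev_rho mu y] 1-Lipschitz in the required direction, and it grows by 1 along the first edge of
   a geodesic to [y]. *)
have rhoLip a b : - rev_rho mu y b - - rev_rho mu y a <= (ddist mu a b)%:R.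
  by rewrite opprK addrC lerBlDr -natrD ler_nat ddist_triangle.
have lapN v : laplacian mu m (fun u => - rev_rho mu y u) v =
              - laplacian mu m (rev_rho mu y) v.
  rewrite /laplacian opprB addrC; congr (_ + _).
  by rewrite -sumrN; apply: eq_bigr => u _; rewrite mulrN opprK.
have rho1 : - rev_rho mu y w - - rev_rho mu y z = 1.
  by rewrite /rev_rho zy wy -natr1; ring.
have := inf_ricci_le_laplacian rhoLip zw rho1; rewrite !lapN.
by have := IHn w wy; lra.
Qed.

End Comparison.

Theorem theorem4p4 (R : realType) (V : finType) (mu : V -> V -> R)
    (card_V : (1 < #|V|)%N)
    (mu_ge0 : forall x y, 0 <= mu x y)
    (mu_simple : simple_graph mu)
    (mu_conn : strongly_connected mu)
    (m : V -> R) (m_perron : perron_measure mu m)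
    (K_gt0 : 0 < inf_ricci mu m)
    (diam_eq : (diam mu)%:R = sup_mean_curv mu m / inf_ricci mu m)
    (x y : V) (dxy : ddist mu x y = diam mu) :
  (forall z, laplacian mu m (rho mu x) z
             = inf_ricci mu m * rho mu x z + mean_curv mu m x) /\
  (forall z, laplacian mu m (rev_rho mu y) z
             = inf_ricci mu m * rev_rho mu y z + rev_mean_curv mu m y).
Proof.
have m_gt0 := perron_gt0 card_V mu_ge0 mu_conn m_perron.
have rho_ge := laplacian_rho_ge card_V mu_ge0 mu_conn m_perron K_gt0 x.
have rev_rho_ge := laplacian_rev_rho_ge card_V mu_ge0 mu_conn m_perron K_gt0 y.
set K := inf_ricci mu m in K_gt0 diam_eq rho_ge rev_rho_ge *.
set D : R := (diam mu)%:R in diam_eq.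
(* The diameter hypothesis says that [K * D] is the supremum of the mixed mean curvatures. *)
have curv_le : mixed_mean_curv mu m x y <= K * D.
  rewrite diam_eq mulrC divfK ?gt_eqF //.
  by apply: ub_le_sup; [exact: has_ubound_image_fin|exists (x, y)].
have D_le z : D <= rho mu x z + rev_rho mu y z.
  by rewrite /D -dxy -natrD ler_nat ddist_triangle.
have KD_le z : K * D <= K * rho mu x z + K * rev_rho mu y z.
  by rewrite -mulrDr ler_pM2l.
pose Lf z := laplacian mu m (rho mu x) z + laplacian mu m (rev_rho mu y) z.
have Lf_ge0 z : 0 <= Lf z.
  have := rho_ge z; have := rev_rho_ge z; have := KD_le z.
  by move: curv_le; rewrite /mixed_mean_curv /Lf; lra.
have sum_mLf : \sum_z m z * Lf z = 0.
  under eq_bigr do rewrite mulrDr.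
  by rewrite big_split /= !perron_laplacian ?addr0.
(* Nonnegative terms with zero sum all vanish, and the weight [m z] is positive. *)
have Lf0 z : Lf z = 0.
  have mLf_ge0 u : true -> 0 <= m u * Lf u by rewrite mulr_ge0 // ltW.
  have /eqP := psumr_eq0P mLf_ge0 sum_mLf (i := z) isT.
  by rewrite mulf_eq0 gt_eqF // => /eqP.
(* The slacks of the two comparisons are nonnegative, and by [Lf z = 0], [KD_le] and [curv_le] their
   sum is at most 0, so each vanishes. *)
split=> z; have := rho_ge z; have := rev_rho_ge z; have := KD_le z;
  by move: curv_le (Lf0 z); rewrite /mixed_mean_curv /Lf; lra.
Qed.
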